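(* Let a $C^0$ flow on a generalized Peano continuum $M$ be given. If any of the following two conditions holds, then every neighbourhood (in $M$) of each compact minimal set of the flow contains infinitely many Lyapunov unstable compact minimal sets: (1) $\mathrm{CMin}$ is not locally connected at a dense subset of its points; (2) no point of $\mathrm{CMin}$ has both a compact neighbourhood and a locally connected neighbourhood (in $\mathrm{CMin}$).
   Context: A generalized Peano continuum is a locally compact, connected and locally connected metric space. A $C^0$ flow on $M$ is a continuous action of $(\mathbb{R},+)$ on $M$. A minimal set is a nonempty closed invariant set containing no smaller nonempty closed invariant set. $\mathrm{CMin}$ is the set of all compact minimal sets of the flow, endowed with the Hausdorff metric $d_H$. A neighbourhood of a set $Y\subset M$ is a set whose interior contains $Y$. A nonempty compact invariant set $K$ is (Lyapunov) stable if every neighbourhood of $K$ contains a positively invariant neighbourhood of $K$; otherwise (Lyapunov) unstable. Condition (1) means that the set of points of $\mathrm{CMin}$ at which $\mathrm{CMin}$ is not locally connected is dense in $\mathrm{CMin}$. *)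

(* Defs.v *)
From HB Require Import structures.
From mathcomp Require Import all_boot all_order all_algebra.
From mathcomp Require Import all_classical all_reals all_analysis.

Set Implicit Arguments.
Unset Strict Implicit.
Unset Printing Implicit Defensive.

Import Order.TTheory GRing.Theory Num.Theory.
Import numFieldNormedType.Exports.

Local Open Scope classical_set_scope.
Local Open Scope ring_scope.

(* Local connectedness of the subspace A, relative to A as in the library's
   [locally_compact].  Neighbourhoods are not required to be open: A is locally
   connected at x when x has arbitrarily small connected neighbourhoods in A. *)
Definition locally_connected_at (T : topologicalType) (A : set T) (x : T) :=
  forall U : set T, nbhs x U ->
    exists V : set T,
      [/\ within A (nbhs x) V, V `<=` A `&` U & connected V].

Definition locally_connected (T : topologicalType) (A : set T) :=
  forall x : T, A x -> locally_connected_at A x.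

Definition generalized_peano_continuum (R : realType) (M : metricType R) :=
  [/\ locally_compact [set: M], connected [set: M]
    & locally_connected [set: M]].

Definition is_flow (R : realType) (M : metricType R) (phi : R -> M -> M) :=
  [/\ continuous (fun p : R * M => phi p.1 p.2),
      forall x, phi 0 x = x
    & forall s t x, phi (s + t) x = phi s (phi t x)].

Section dynamics.
Context {R : realType} {M : metricType R} (phi : R -> M -> M).

Definition invariant_set (A : set M) := forall t x, A x -> A (phi t x).

Definition positively_invariant_set (A : set M) :=
  forall t x, 0 <= t -> A x -> A (phi t x).

Definition minimal_set (A : set M) :=
  [/\ A !=set0, closed A, invariant_set A
    & forall B : set M, B !=set0 -> closed B -> invariant_set B ->
        B `<=` A -> B = A].

Definition compact_minimal_set (A : set M) := compact A /\ minimal_set A.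

(* Meant for nonempty compact invariant sets K. *)
Definition lyapunov_stable (K : set M) :=
  forall U : set M, K `<=` U° ->
    exists V : set M,
      [/\ K `<=` V°, positively_invariant_set V & V `<=` U].

Definition lyapunov_unstable (K : set M) := ~ lyapunov_stable K.

End dynamics.

Section hausdorff_distance.
Context {R : realType} {M : metricType R}.
Implicit Types A B C : set M.

Definition dist_to_set (x : M) A : R := inf [set mdist x a | a in A].

Definition hausdorff_excess A B : R := sup [set dist_to_set a B | a in A].

(* The junk values of inf and sup do not occur for nonempty bounded sets. *)
Definition hausdorff_dist A B : R :=
  Num.max (hausdorff_excess A B) (hausdorff_excess B A).

Lemma dist_to_set_le x A a : A a -> dist_to_set x A <= mdist x a.
Proof.
move=> Aa; apply: ge_inf; last by exists a.
by exists 0 => _ [b _ <-]; exact: mdist_ge0.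
Qed.

Lemma le_dist_to_set x A (r : R) : A !=set0 ->
  (forall a, A a -> r <= mdist x a) -> r <= dist_to_set x A.
Proof.
move=> [a Aa] h; apply: lb_le_inf; first by exists (mdist x a); exists a.
by move=> _ [b Ab <-]; exact: h.
Qed.

Lemma compact_mdist_bounded A (x : M) : compact A ->
  exists r : R, forall a, A a -> mdist a x <= r.
Proof.
move=> /compact_near_coveringP/(_ R +oo (fun r a => mdist a x <= r)) cA.
have /cA : forall a, A a -> \forall a' \near a & r \near +oo, mdist a' x <= r.
  move=> a _; exists (ball a 1, [set r | 1 + mdist a x <= r]) => /=.
    by split; [exact: nbhsx_ballx | apply: nbhs_pinfty_ge; exact: num_real].
  move=> [a' r] /= []; rewrite ballEmdist/= => aa' h.
  apply: le_trans h; apply: le_trans (metric_triangle _ a _) _.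
  by rewrite lerD2r metric_sym ltW.
move=> h; have [r hr] := @filter_ex _ (+oo : set_system R) _ _ h.
by exists r.
Qed.

Lemma le_hausdorff_excess A B a : compact A -> B !=set0 -> A a ->
  dist_to_set a B <= hausdorff_excess A B.
Proof.
move=> cA [b Bb] Aa; apply: ub_le_sup; last by exists a.
have [r hr] := compact_mdist_bounded b cA.
by exists r => _ [c Ac <-]; apply: le_trans (hr _ Ac); exact: dist_to_set_le.
Qed.

Lemma hausdorff_excess_le A B (r : R) : A !=set0 ->
  (forall a, A a -> dist_to_set a B <= r) -> hausdorff_excess A B <= r.
Proof.
move=> [a Aa] h; apply: ge_sup; first by exists (dist_to_set a B); exists a.
by move=> _ [b Ab <-]; exact: h.
Qed.

Lemma hausdorff_excess_triangle A B C : compact A -> compact B ->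
  A !=set0 -> B !=set0 -> C !=set0 ->
  hausdorff_excess A C <= hausdorff_excess A B + hausdorff_excess B C.
Proof.
move=> cA cB A0 B0 C0; apply: hausdorff_excess_le => // a Aa.
rewrite -lerBlDr; apply: le_trans (le_hausdorff_excess cA B0 Aa).
apply: le_dist_to_set => // b Bb; rewrite lerBlDr.
apply: (@le_trans _ _ (mdist a b + dist_to_set b C)); last first.
  by rewrite lerD2l; exact: le_hausdorff_excess.
rewrite -lerBlDl; apply: le_dist_to_set => // c Cc; rewrite lerBlDl.
by apply: le_trans (metric_triangle _ b _); exact: dist_to_set_le.
Qed.

Lemma hausdorff_distC A B : hausdorff_dist A B = hausdorff_dist B A.
Proof. by rewrite /hausdorff_dist maxC. Qed.

Lemma hausdorff_dist_triangle A B C : compact A -> compact B -> compact C ->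
  A !=set0 -> B !=set0 -> C !=set0 ->
  hausdorff_dist A C <= hausdorff_dist A B + hausdorff_dist B C.
Proof.
move=> cA cB cC A0 B0 C0; rewrite {1}/hausdorff_dist ge_max; apply/andP; split.
  apply: le_trans (hausdorff_excess_triangle cA cB A0 B0 C0) _.
  by apply: lerD; rewrite /hausdorff_dist le_max lexx.
apply: le_trans (hausdorff_excess_triangle cC cB C0 B0 A0) _.
by rewrite addrC; apply: lerD; rewrite /hausdorff_dist le_max lexx orbT.
Qed.

Lemma hausdorff_excess_sub A B : compact A -> closed B -> B !=set0 ->
  hausdorff_excess A B <= 0 -> A `<=` B.
Proof.
move=> cA clB B0 AB a Aa; apply: clB => U /= /nbhs_ballP[e /= e0 eU].
have : dist_to_set a B < e.
  by apply: le_lt_trans e0; apply: le_trans AB; exact: le_hausdorff_excess.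
rewrite ltNge => /negP le_e; apply: contrapT => BU; apply: le_e.
apply: le_dist_to_set => // b Bb; rewrite leNgt; apply/negP => abe.
by apply: BU; exists b; split=> //; apply: eU; rewrite ballEmdist.
Qed.

Lemma hausdorff_dist_eq0 A B : compact A -> compact B ->
  A !=set0 -> B !=set0 -> hausdorff_dist A B = 0 -> A = B.
Proof.
move=> cA cB A0 B0 /eqP; rewrite eq_le => /andP[+ _].
rewrite /hausdorff_dist ge_max => /andP[AB BA].
have cl (X : set M) : compact X -> closed X.
  exact: compact_closed (@metric_hausdorff R M).
by apply/seteqP; split; apply: hausdorff_excess_sub => //; exact: cl.
Qed.

Lemma hausdorff_distxx A : compact A -> A !=set0 -> hausdorff_dist A A = 0.
Proof.
move=> cA A0; rewrite /hausdorff_dist maxxx.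
have dAA a : A a -> dist_to_set a A = 0.
  move=> Aa; apply/eqP; rewrite eq_le -{1}(mdistxx a) dist_to_set_le//=.
  by apply: le_dist_to_set => // b _; exact: mdist_ge0.
apply/eqP; rewrite eq_le; apply/andP; split.
  by apply: hausdorff_excess_le => // a /dAA ->.
by case: (A0) => a Aa; rewrite -(dAA _ Aa); exact: le_hausdorff_excess.
Qed.

End hausdorff_distance.

(* The hyperspace of compact minimal sets, topologized below by the Hausdorff
   metric.  It is a record rather than a [set_type] so that it cannot inherit
   any other topology from [set M]. *)
Record CMin (R : realType) (M : metricType R) (phi : R -> M -> M) := MkCMin {
  cmin_set :> set M;
  cmin_setP : compact_minimal_set phi cmin_set
}.

Section cmin_metric.
Context {R : realType} {M : metricType R} (phi : R -> M -> M).
Implicit Types K L : CMin phi.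

HB.instance Definition _ := gen_eqMixin (CMin phi).
HB.instance Definition _ := gen_choiceMixin (CMin phi).

Let cmin_dist K L : R := hausdorff_dist K L.

Let cmin_compact K : compact K.
Proof. by case: (cmin_setP K). Qed.

Let cmin_neq0 K : (K : set M) !=set0.
Proof. by case: (cmin_setP K) => _ []. Qed.

Let cmin_distxx K : cmin_dist K K = 0.
Proof. exact: hausdorff_distxx. Qed.

Let cmin_dist_positivity K L : cmin_dist K L = 0 -> K = L.
Proof.
move=> /hausdorff_dist_eq0 KL.
have {KL} : (K : set M) = L by exact: KL.
case: K L => [K KP] [L LP] /= KL; case: _ / KL LP => LP.
by rewrite (Prop_irrelevance KP LP).
Qed.

Let cmin_dist_sym K L : cmin_dist K L = cmin_dist L K.
Proof. exact: hausdorff_distC. Qed.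

Let cmin_dist_triangle K L N :
  cmin_dist L N <= cmin_dist L K + cmin_dist K N.
Proof. exact: hausdorff_dist_triangle. Qed.

HB.instance Definition _ := isMetric.Build R (CMin phi)
  cmin_distxx cmin_dist_positivity cmin_dist_sym cmin_dist_triangle.

End cmin_metric.

Lemma cmin_mdistE (R : realType) (M : metricType R) (phi : R -> M -> M)
  (K L : CMin phi) : mdist K L = hausdorff_dist K L.
Proof. by []. Qed.

(* Main.v *)
Require Import Defs.
From HB Require Import structures.
From mathcomp Require Import all_boot all_order all_algebra.
From mathcomp Require Import all_classical all_reals all_analysis.

Set Implicit Arguments.
Unset Strict Implicit.
Unset Printing Implicit Defensive.

Import Order.TTheory GRing.Theory Num.Theory.
Import numFieldNormedType.Exports.

Local Open Scope classical_set_scope.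
Local Open Scope ring_scope.

(** Suppose that a neighbourhood U of a compact minimal set contains only
finitely many unstable compact minimal sets.  Each of the two conditions forbids
a point of CMin that has both a compact and a locally connected neighbourhood
([has_tame_nbhs]), so it suffices to produce such a point.  Finite sets are closed
in CMin; hence either the given minimal set is isolated in CMin, and is itself
such a point, or some compact minimal set K inside U is such that every point
of CMin close to K is stable ([near_finite_exceptions_tame]).

In the latter case K has, by its own stability and by local compactness, a
compact positively invariant neighbourhood V all of whose minimal sets are
stable ([stable_trapping_region]).  The omega-limit set of a point x of V
contains a compact minimal set by Zorn's lemma, and equals it because that set
is stable.  This defines a map from V to CMin ([limit_map]) which sends every
point of a minimal set L contained in V to L.  It is continuous
([limit_map_continuous]): once the orbit of x has entered a small positively
invariant neighbourhood N of its limit, so have the orbits of all nearby points,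
whose limits then lie in the closure of N; and minimal sets contained in a small
neighbourhood of a compact minimal set L are close to L in the Hausdorff metric,
not just in the one-sided excess, because orbits that start close to L come
close to all of L ([cmin_near_from_subset]).

The image of V is therefore a compact neighbourhood of K in CMin.  Moreover a
connected neighbourhood of a point p of L in M is mapped onto a connected
neighbourhood of L in CMin, since every minimal set that is Hausdorff-close to L
passes close to p.  So local connectedness descends from M to CMin. *)

(** * Neighbourhoods of compact sets in metric spaces *)

Section metric_neighbourhoods.
Context {R : realType} {M : metricType R}.
Implicit Types (A B W : set M) (x y : M).

Definition thickening A (e : R) : set M := \bigcup_(a in A) ball a e.

Lemma open_thickening A e : 0 < e -> A `<=` (thickening A e)°.
Proof.
move=> e0 a Aa; apply: filterS (nbhsx_ballx a e e0) => y ay.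
by exists a.
Qed.

Lemma compact_thickening_subset A W : compact A -> open W -> A `<=` W ->
  exists2 e : R, 0 < e & thickening A e `<=` W.
Proof.
move=> /compact_near_coveringP cA oW AW.
have /cA h : forall a, A a ->
    \forall a' \near a & e \near (0 : R)^'+, ball a' e `<=` W.
  move=> a /AW Wa; have /nbhs_ballP[r /= r0 rW] := open_nbhs_nbhs (conj oW Wa).
  exists (ball a (r / 2), [set e | e < r / 2]) => /=.
    split; first by apply: nbhsx_ballx; rewrite divr_gt0.
    by apply: nbhs_right_lt; rewrite divr_gt0.
  move=> [a' e] /= [aa' er] y a'y; apply: rW; rewrite (splitr r).
  by apply: ball_triangle aa' _; exact: le_ball (ltW er) _ a'y.
have [e [/= e0 he]] := filter_ex (filterI (nbhs_right_gt (0 : R)) h).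
by exists e => // y [a Aa]; exact: he.
Qed.

Lemma closure_thickening_half A e :
  0 < e -> closure (thickening A (e / 2)) `<=` thickening A e.
Proof.
move=> e0 x /(_ _ (nbhsx_ballx x (e / 2) _))[|y [[a Aa ay] /ball_sym yx]].
  by rewrite divr_gt0.
by exists a => //; rewrite (splitr e); exact: ball_triangle ay yx.
Qed.

Lemma compact_closed_neighbourhood A W : compact A -> open W -> A `<=` W ->
  exists2 B, A `<=` B° & closure B `<=` W.
Proof.
move=> cA oW AW; have [e e0 eW] := compact_thickening_subset cA oW AW.
exists (thickening A (e / 2)); first by apply: open_thickening; rewrite divr_gt0.
by apply: subset_trans eW; exact: closure_thickening_half.
Qed.

(** Near-covering is applied to the filter, on sets D, generated by the families
of all supersets of a given compact set C; compact sets are stable under finite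
unions, so this is a filter.  Each point of A lies in D° for all D large in this
sense, hence so does A as a whole. *)
Lemma compact_compact_neighbourhood A : locally_compact [set: M] ->
  compact A -> exists2 C, A `<=` C° & compact C.
Proof.
move=> lcM /compact_near_coveringP cA.
pose cc : set (set M) := [set C | compact C].
have FF : Filter (filter_from cc (fun C => [set D | C `<=` D])).
  apply: filter_from_filter; first by exists set0; exact: compact0.
  move=> C D cC cD; exists (C `|` D); first exact: compactU.
  by move=> E CDE; split=> y ?; apply: CDE; [left|right].
have /cA [C cC] : forall a, A a -> \forall a' \near a &
    D \near filter_from cc (fun C => [set D | C `<=` D]), D° a'.
  move=> a _; have [C] := lcM a I.
  rewrite within_interior ?interiorT// => nC [cC _].
  exists (C°, [set D | C `<=` D]) => /=.
    split; last by exists C.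
    exact: nbhs_interior.
  by move=> [a' D] /= [Ca' CD]; exact: interiorS Ca'.
by move=> /(_ C (@subset_refl _ C)) AC; exists C.
Qed.

Lemma hausdorff_dist_thickening A B e : A !=set0 -> B !=set0 -> compact A ->
  compact B -> hausdorff_dist A B < e -> A `<=` thickening B e.
Proof.
move=> A0 B0 cA cB; rewrite /hausdorff_dist gt_max => /andP[AB _] a Aa.
have /inf_lt := le_lt_trans (le_hausdorff_excess cA B0 Aa) AB.
case=> [|_ [b Bb <-] abe]; first by have [b Bb] := B0; exists (mdist a b), b.
by exists b => //; apply: ball_sym; rewrite ballEmdist.
Qed.

Lemma le_hausdorff_dist A B e : A !=set0 -> B !=set0 ->
  A `<=` thickening B e -> B `<=` thickening A e -> hausdorff_dist A B <= e.
Proof.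
have h A' B' : A' !=set0 -> A' `<=` thickening B' e ->
    hausdorff_excess A' B' <= e.
  move=> A0 AB; apply: hausdorff_excess_le => // a /AB[b Bb /ball_sym].
  rewrite ballEmdist /= => /ltW; apply: le_trans; exact: dist_to_set_le.
by move=> A0 B0 AB BA; rewrite /hausdorff_dist ge_max !h.
Qed.

End metric_neighbourhoods.

(** * Omega-limit sets and existence of minimal sets *)

Section limit_sets.
Context {R : realType} {M : metricType R} (phi : R -> M -> M).
Hypothesis hphi : is_flow phi.
Implicit Types (A L : set M) (x p : M).

Lemma flow_map_continuous t : continuous (phi t).
Proof.
case: hphi => c _ _ x.
have := @continuous2_cvg M R M M (nbhs x) _ (fun=> t) id phi t x (c (t, x)).
by apply; [exact: cvg_cst | exact: cvg_id].
Qed.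

Lemma closure_positively_invariant A : positively_invariant_set phi A ->
  positively_invariant_set phi (closure A).
Proof.
move=> pA t x t0 clx B /(flow_map_continuous (x := x)) /clx[y [Ay By]].
by exists (phi t y); split=> //; exact: pA.
Qed.

Definition omega_limit x : set M := cluster (phi ^~ x @ +oo).

Lemma omega_limit_closed x : closed (omega_limit x).
Proof.
by rewrite /omega_limit clusterE; apply: closed_bigI => A _; exact: closed_closure.
Qed.

Lemma omega_limit_invariant x : invariant_set phi (omega_limit x).
Proof.
move=> s p xp A B /= [m [_ mA]] nB; case: hphi => _ _ phiD.
have [] := xp [set y | A (phi s y)] [set y | B (phi s y)].
- exists (m - s); split; first exact: num_real.
  by move=> t /= mt; rewrite -phiD; apply: mA; rewrite -ltrBlDl.
- exact: flow_map_continuous nB.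
by move=> y [? ?]; exists (phi s y).
Qed.

Lemma omega_limit_sub x A : (\forall t \near +oo, A (phi t x)) ->
  omega_limit x `<=` closure A.
Proof. by move=> xA p xp B nB; exact: xp. Qed.

Lemma omega_limit_neq0 x A : compact A -> (\forall t \near +oo, A (phi t x)) ->
  omega_limit x !=set0.
Proof. by move=> cA /(cA (phi ^~ x @ +oo) _)[p [_ xp]]; exists p. Qed.

Lemma omega_limit_minimal L x :
  compact_minimal_set phi L -> L x -> omega_limit x = L.
Proof.
move=> [cL [L0 clL iL mL]] Lx; have xL t : L (phi t x) by exact: iL.
apply: mL; [| exact: omega_limit_closed | exact: omega_limit_invariant |].
  by apply: omega_limit_neq0 cL _; exact: nearW.
by rewrite [X in _ `<=` X](iffLR (closure_id _) clL); apply: omega_limit_sub; exact: nearW.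
Qed.

(** Zorn's lemma is available for unions of chains, so it is applied to the
complements in A of the nonempty closed invariant subsets of A. *)
Lemma exists_compact_minimal A : compact A -> A !=set0 -> invariant_set phi A ->
  exists2 L, compact_minimal_set phi L & L `<=` A.
Proof.
move=> cA A0 iA.
have clA : closed A := compact_closed (@metric_hausdorff R M) cA.
pose P : set (set M) := [set X |
  [/\ A `\` X !=set0, closed (A `\` X) & invariant_set phi (A `\` X)]].
have P0 : P set0 by rewrite /P /= setD0.
have [|X [[X0 clX iX] maxX]] := @Zorn_bigcup _ P.
  move=> F FP totF.
  (* adding the empty set to the chain makes the intersection range over a
     nonempty family, so that it is contained in A even for the empty chain *)
  have eqD : A `\` \bigcup_(X in F) X =
      \bigcap_(X in F `|` [set set0]) (A `\` X).
    apply/seteqP; split=> [y [Ay nFy] X FX|y h].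
      by split=> // Xy; case: FX => [FX|X0]; [apply: nFy; exists X | rewrite X0 in Xy].
    have [Ay _] := h set0 (or_intror erefl).
    by split=> // -[X FX Xy]; have [] := h X (or_introl FX).
  rewrite /P /= eqD; have FP' X : (F `|` [set set0]) X -> P X.
    by move=> [/FP//|->].
  split.
  - have FF : ProperFilter (filter_from (F `|` [set set0]) (fun X => A `\` X)).
      apply: filter_from_proper => [|X /FP'[]//].
      apply: filter_from_filter; first by exists set0; right.
      move=> X Y [FX|->] [FY|->].
      + have [XY|YX] := totF _ _ FX FY.
          exists Y; first by left.
          by move=> y [Ay nY]; split; split=> // /XY.
        exists X; first by left.
        by move=> y [Ay nX]; split; split=> // /YX.
      + by exists X; [left | move=> y [Ay nX]; split; split].
      + by exists Y; [left | move=> y [Ay nX]; split; split].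
      + by exists set0; [right | move=> y [Ay nX]; split; split].
    have [] := cA _ FF; first by exists set0; [right | move=> y []].
    move=> p [_ clp]; exists p => X FX; have [_ clX _] := FP' X FX.
    by apply: clX => B nB; apply: clp => //; exists X.
  - by apply: closed_bigI => X /FP'[].
  - by move=> t x h X FX; have [_ _ iX] := FP' X FX; apply: iX; exact: h.
exists (A `\` X); last exact: subDsetl.
split; first exact: subclosed_compact cA (@subDsetl _ _ _).
split=> // B B0 clB iB BX; apply/seteqP; split=> // y [Ay nXy].
apply: contrapT => nBy; apply: (maxX (X `|` A `\` B)).
  by split; [move=> z Xz; left | move=> h; apply: nXy; apply: h; right].
suff eqB : A `\` (X `|` A `\` B) = B by rewrite /P /= eqB.
apply/seteqP; split=> [z [Az nz]|z Bz].
  by apply: contrapT => nBz; apply: nz; right.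
by have [Az nXz] := BX z Bz; split=> // -[//|[_]].
Qed.
End limit_sets.

(** * Stable minimal sets *)

Section stability.
Context {R : realType} {M : metricType R} (phi : R -> M -> M).
Hypothesis hphi : is_flow phi.
Implicit Types (A L V : set M) (x p : M).

Lemma omega_limit_visits x p A :
  omega_limit phi x p -> nbhs p A -> exists t, A (phi t x).
Proof.
move=> xp nA; have xr : (phi ^~ x @ +oo) (range (phi ^~ x)).
  by exists 0; split=> [|t _]; [exact: num_real | exists t].
by have [_ [[t _ <-] At]] := xp _ _ xr nA; exists t.
Qed.

Lemma positively_invariant_eventually V x t :
  positively_invariant_set phi V -> V (phi t x) ->
  \forall s \near +oo, V (phi s x).
Proof.
case: hphi => _ _ phiD pV Vt; exists t; split; first exact: num_real.
move=> s /= ts; rewrite -(subrK t s) phiD.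
by apply: pV Vt; rewrite subr_ge0 ltW.
Qed.

(** Stability upgrades visiting L arbitrarily closely to staying close to L: an
orbit that enters a positively invariant neighbourhood of L never leaves it. *)
Lemma stable_omega_limit_subset L x : compact_minimal_set phi L ->
  lyapunov_stable phi L -> L `&` omega_limit phi x !=set0 ->
  omega_limit phi x `<=` L.
Proof.
move=> [cL _] sL [p [Lp xp]] q xq; apply: contrapT => nLq.
have oq : open (~` [set q]).
  apply: closed_openC; apply: accessible_closed_set1.
  exact/hausdorff_accessible/metric_hausdorff.
have [|B LB clB] := compact_closed_neighbourhood cL oq.
  by move=> y Ly /= yq; apply: nLq; rewrite -yq.
have [V [LV pV VB]] := sL _ LB.
have [t Vt] := omega_limit_visits xp (LV _ Lp).
have xV := positively_invariant_eventually pV Vt.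
by apply: (clB _ (closureS VB (omega_limit_sub xV xq))).
Qed.

Lemma stable_omega_limit L C x : compact_minimal_set phi L ->
  lyapunov_stable phi L -> compact C -> (\forall t \near +oo, C (phi t x)) ->
  L `&` omega_limit phi x !=set0 -> omega_limit phi x = L.
Proof.
move=> mL sL cC xC Lx; have [_ [_ _ _]] := mL; apply.
- exact: omega_limit_neq0 cC xC.
- exact: omega_limit_closed.
- exact: omega_limit_invariant.
- exact: stable_omega_limit_subset Lx.
Qed.

Lemma stable_trapping_region L W : locally_compact [set: M] ->
  compact L -> lyapunov_stable phi L -> open W -> L `<=` W ->
  exists V, [/\ compact V, positively_invariant_set phi V, L `<=` V°
    & V `<=` W].
Proof.
move=> lcM cL sL oW LW.
have [C LC cC] := compact_compact_neighbourhood lcM cL.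
have [B LB clB] := compact_closed_neighbourhood cL oW LW.
have LCB : L `<=` (C `&` B)° by rewrite interiorI subsetI.
have [V [LV pV]] := sL _ LCB.
rewrite subsetI => -[VC VB]; exists (closure V); split.
- apply: (subclosed_compact _ cC); first exact: closed_closure.
  have clC : closed C := compact_closed (@metric_hausdorff R M) cC.
  by rewrite [X in _ `<=` X](iffLR (closure_id _) clC); exact: closureS.
- exact: closure_positively_invariant.
- by apply: subset_trans LV _; apply: interiorS; exact: subset_closure.
- by apply: subset_trans clB; exact: closureS.
Qed.

End stability.

(** * The Hausdorff topology on the space of compact minimal sets *)

Section hyperspace.
Context {R : realType} {M : metricType R} (phi : R -> M -> M).
Hypothesis hphi : is_flow phi.
Implicit Types (K L : CMin phi) (W : set M).

Lemma cmin_compact K : compact (K : set M).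
Proof. by case: (cmin_setP K). Qed.

Lemma cmin_neq0 K : (K : set M) !=set0.
Proof. by case: (cmin_setP K) => _ []. Qed.

Lemma cmin_invariant K : invariant_set phi K.
Proof. by case: (cmin_setP K) => _ []. Qed.

Lemma cmin_set_inj : injective (@cmin_set R M phi).
Proof.
move=> [K KP] [L LP] /= KL; case: _ / KL LP => LP.
by rewrite (Prop_irrelevance KP LP).
Qed.

Lemma near_cmin_subset K W : open W -> K `<=` W ->
  \forall L \near K, cmin_set L `<=` W.
Proof.
move=> oW /(compact_thickening_subset (@cmin_compact K) oW)[e e0 eW].
apply/nbhs_ballP; exists e => //= L; rewrite ballEmdist /= cmin_mdistE => KL.
apply: subset_trans eW; apply: hausdorff_dist_thickening.
- exact: cmin_neq0.
- exact: cmin_neq0.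
- exact: cmin_compact.
- exact: cmin_compact.
- by rewrite hausdorff_distC.
Qed.

Lemma near_cmin_meet K p A : (K : set M) p -> nbhs p A ->
  \forall L \near K, cmin_set L `&` A !=set0.
Proof.
move=> Kp /nbhs_ballP[e /= e0 eA].
apply/nbhs_ballP; exists e => //= L; rewrite ballEmdist /= cmin_mdistE => KL.
have [||||q Lq qp] := hausdorff_dist_thickening _ _ _ _ KL Kp.
- exact: cmin_neq0.
- exact: cmin_neq0.
- exact: cmin_compact.
- exact: cmin_compact.
by exists q; split=> //; apply: eA; exact: ball_sym.
Qed.

(** Every orbit in K is dense in K; that it is e-dense is, by compactness of K, an
open condition on its starting point, so it extends to a neighbourhood of K. *)
Lemma near_orbit_dense K e : 0 < e ->
  exists W, [/\ open W, K `<=` W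
    & forall p q, W p -> cmin_set K q -> exists t, ball (phi t p) e q].
Proof.
move=> e0; have e20 : 0 < e / 2 by rewrite divr_gt0.
pose W := [set p | forall q, cmin_set K q -> exists t, ball (phi t p) e q].
exists W°; split; first exact: open_interior.
  move=> p Kp; have cK := @cmin_compact K.
  apply: (iffLR (compact_near_coveringP _) cK _ (nbhs p)
    (fun p q => exists t, ball (phi t p) e q)) => q Kq.
  have pq : omega_limit phi p q.
    by rewrite (omega_limit_minimal hphi (cmin_setP K) Kp).
  have [t tq] := omega_limit_visits pq (nbhs_interior (nbhsx_ballx q _ e20)).
  exists (ball q (e / 2), phi t @^-1` ball q (e / 2)) => /=.
    split; first exact: nbhsx_ballx.
    exact: (flow_map_continuous hphi) tq.
  move=> [q' p'] /= [qq' qp']; exists t; rewrite (splitr e).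
  exact: ball_triangle (ball_sym qp') qq'.
by move=> p q /interior_subset; apply.
Qed.

(** For minimal sets the upper topology already determines the Hausdorff one: if L
lies close enough to K, then the orbit of a point of L passes close to every point
of K, which bounds the other excess. *)
Lemma cmin_near_from_subset K (O : set (CMin phi)) : nbhs K O ->
  exists W, [/\ open W, K `<=` W & forall L, (L : set M) `<=` W -> O L].
Proof.
move=> /nbhs_ballP[e /= e0 eO]; have e20 : 0 < e / 2 by rewrite divr_gt0.
have [W [oW KW dW]] := near_orbit_dense K e20.
exists (W `&` (thickening K (e / 2))°); split.
- by apply: openI => //; exact: open_interior.
- by rewrite subsetI; split=> //; exact: open_thickening.
move=> L; rewrite subsetI => -[LW LK]; apply: eO.
rewrite ballEmdist /= cmin_mdistE.
apply: (@le_lt_trans _ _ (e / 2)); last first.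
  by rewrite ltr_pdivrMr// ltr_pMr// ltr1n.
apply: le_hausdorff_dist.
- exact: cmin_neq0.
- exact: cmin_neq0.
- move=> q Kq; have [p Lp] := cmin_neq0 L.
  have [t tq] := dW p q (LW _ Lp) Kq.
  by exists (phi t p) => //; exact: cmin_invariant.
- by apply: subset_trans LK _; exact: interior_subset.
Qed.

End hyperspace.

(** * The limit map of a trapping region with stable minimal sets *)

Section limit_map.
Context {R : realType} {M : metricType R} (phi : R -> M -> M).
Hypothesis hphi : is_flow phi.
Variables (K : CMin phi) (V : set M).
Hypotheses (cV : compact V) (pV : positively_invariant_set phi V).
Hypothesis sV : forall L : CMin phi, cmin_set L `<=` V -> lyapunov_stable phi L.
Implicit Types (L : CMin phi) (x : M).

Let trapped x : V x -> \forall t \near +oo, V (phi t x).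
Proof.
move=> Vx; apply: (positively_invariant_eventually hphi (t := 0) pV).
by case: hphi => _ -> _.
Qed.

Let omega_limit_trapped x : V x -> omega_limit phi x `<=` V.
Proof.
have clV : closed V := compact_closed (@metric_hausdorff R M) cV.
move=> Vx; rewrite [X in _ `<=` X](iffLR (closure_id _) clV).
exact: omega_limit_sub (trapped Vx).
Qed.

Lemma trapped_omega_limit x :
  V x -> exists L : CMin phi, cmin_set L = omega_limit phi x.
Proof.
move=> Vx; have [L mL Lx] : exists2 L, compact_minimal_set phi L &
    L `<=` omega_limit phi x.
  apply: exists_compact_minimal.
  - exact: subclosed_compact (@omega_limit_closed _ _ phi x) cV
      (omega_limit_trapped Vx).
  - exact: omega_limit_neq0 cV (trapped Vx).
  - exact: omega_limit_invariant.
exists (MkCMin mL) => /=; apply/esym.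
apply: (stable_omega_limit hphi mL _ cV (trapped Vx)).
  exact: (sV (L := MkCMin mL) (subset_trans Lx (omega_limit_trapped Vx))).
by have [_ [[p Lp] _ _ _]] := mL; exists p; split=> //; exact: Lx.
Qed.

(** Outside V, where the omega-limit set may fail to be compact minimal, the value
may be the default K. *)
Definition limit_map x : CMin phi :=
  xget K [set L : CMin phi | cmin_set L = omega_limit phi x].

Lemma limit_mapE x : V x -> cmin_set (limit_map x) = omega_limit phi x.
Proof. by move=> /trapped_omega_limit; exact: xgetPex. Qed.

Lemma limit_map_id L x : cmin_set L `<=` V -> cmin_set L x -> limit_map x = L.
Proof.
move=> LV Lx; apply: cmin_set_inj; rewrite limit_mapE; last exact: LV.
exact: omega_limit_minimal (cmin_setP L) Lx.
Qed.

Lemma limit_map_continuous : {within V, continuous limit_map}.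
Proof.
apply/subspace_continuousP => x Vx O /= nO.
have [W [oW xW WO]] := cmin_near_from_subset hphi nO.
have [B xB BW] :=
  compact_closed_neighbourhood (@cmin_compact _ _ _ (limit_map x)) oW xW.
have sx : lyapunov_stable phi (limit_map x).
  by apply: sV; rewrite limit_mapE //; exact: omega_limit_trapped.
have [N [xN pN NB]] := sx _ xB.
have [p xp] := cmin_neq0 (limit_map x).
have xp' : omega_limit phi x p by rewrite -limit_mapE.
have [t Nt] := omega_limit_visits xp' (nbhs_interior (xN _ xp)).
have : \forall y \near x, N (phi t y) by exact: (flow_map_continuous hphi) Nt.
apply: filterS => y Ny Vy; apply: WO; rewrite limit_mapE //.
apply: subset_trans BW; apply: subset_trans (closureS NB).
exact: omega_limit_sub (positively_invariant_eventually hphi pN Ny).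
Qed.

(** The image of V is compact by continuity, and it contains every minimal set L
contained in V because L is the limit of its own points. *)
Lemma stable_region_compact_nbhs :
  cmin_set K `<=` V° -> exists2 A : set (CMin phi), nbhs K A & compact A.
Proof.
move=> KV; exists (limit_map @` V).
  apply: filterS (near_cmin_subset (@open_interior _ V) KV) => L LV.
  have {}LV := subset_trans LV (@interior_subset _ V).
  have [p Lp] := cmin_neq0 L.
  by exists p; [exact: LV | exact: limit_map_id].
exact: continuous_compact limit_map_continuous cV.
Qed.

(** The image of a connected neighbourhood C of a point p of L is a neighbourhood of
L: a minimal set close to L meets C, and is the image of any point where it does. *)
Lemma stable_region_locally_connected_at (B : set (CMin phi)) L :
  locally_connected [set: M] -> nbhs L B -> cmin_set L `<=` V° ->
  locally_connected_at B L.
Proof.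
move=> lcM nB LV U nU; have [W [oW LW WBU]] :=
  cmin_near_from_subset hphi (filterI nB nU).
have [p Lp] := cmin_neq0 L.
have LV' := subset_trans LV (@interior_subset _ V).
have : nbhs p (V `&` limit_map @^-1` (B `&` U)).
  have : within V (nbhs p) (limit_map @^-1` (B `&` U)).
    have nBU : nbhs (limit_map p) (B `&` U).
      by rewrite (limit_map_id LV' Lp); exact: filterI.
    exact: (iffLR (subspace_continuousP _ _) limit_map_continuous p (LV' _ Lp)).
  move=> nlim; apply: filterS2 (LV _ Lp) nlim => y Vy h.
  by split=> //; exact: h.
move=> /(lcM p I)[C []]; rewrite within_interior ?interiorT// setTI => nC CV cC.
exists (limit_map @` C); split.
- apply: filterS (filterI (near_cmin_meet Lp nC)
    (near_cmin_subset (@open_interior _ V) LV)) => L' [[q [L'q Cq]] L'V] _.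
  exists q => //; apply: limit_map_id L'q.
  exact: subset_trans L'V (@interior_subset _ V).
- by move=> _ [y Cy <-]; have [] := CV y Cy.
- apply: connected_continuous_connected => //.
  by apply: continuous_subspaceW limit_map_continuous => y /CV[].
Qed.

End limit_map.

(** * Points with a compact and a locally connected neighbourhood *)

Section tame_points.
Context {R : realType} {M : metricType R} (phi : R -> M -> M).
Hypothesis hphi : is_flow phi.
Implicit Types (K L : CMin phi).

Definition has_tame_nbhs K :=
  (exists2 A : set (CMin phi), nbhs K A & compact A) /\
  (exists2 B : set (CMin phi), nbhs K B & locally_connected B).

Lemma isolated_tame K : open [set K] -> has_tame_nbhs K.
Proof.
move=> oK; have nK : nbhs K [set K] by apply: open_nbhs_nbhs; split.
split; exists [set K] => //; first exact: compact_set1.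
move=> _ -> U nU; exists [set K]; split.
- by apply: filterS nK => L.
- by rewrite subsetI; split=> // _ ->; exact: nbhs_singleton nU.
- exact: connected1.
Qed.

Lemma near_stable_tame K : locally_compact [set: M] ->
  locally_connected [set: M] ->
  (\forall L \near K, lyapunov_stable phi (cmin_set L)) -> has_tame_nbhs K.
Proof.
move=> lkM lcM sK; have [W [oW KW sW]] := cmin_near_from_subset hphi sK.
have [V [cV pV KV VW]] :=
  stable_trapping_region hphi lkM (@cmin_compact _ _ _ K) (nbhs_singleton sK) oW KW.
have sV (L : CMin phi) : cmin_set L `<=` V -> lyapunov_stable phi L.
  by move=> LV; apply: sW; exact: subset_trans VW.
split; first exact: stable_region_compact_nbhs sV KV.
have nK : nbhs K [set L : CMin phi | cmin_set L `<=` V°].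
  exact: near_cmin_subset (@open_interior _ V) KV.
exists [set L : CMin phi | cmin_set L `<=` V°]°; first exact: nbhs_interior.
move=> L LV; apply: (stable_region_locally_connected_at hphi K cV pV sV lcM).
  by apply: open_nbhs_nbhs; split=> //; exact: open_interior.
exact: interior_subset LV.
Qed.

Lemma near_finite_exceptions_tame K (S : set (set M)) :
  locally_compact [set: M] -> locally_connected [set: M] -> finite_set S ->
  (\forall L \near K, ~ S (cmin_set L) -> lyapunov_stable phi (cmin_set L)) ->
  exists L, has_tame_nbhs L.
Proof.
move=> lkM lcM fS GK.
pose G := [set L : CMin phi | ~ S L -> lyapunov_stable phi L]°.
have oG : open G by exact: open_interior.
have GS L : G L -> ~ S L -> lyapunov_stable phi L by move/interior_subset.
have clfin : forall E : set (CMin phi), finite_set E -> closed E.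
  apply/accessible_finite_set_closed.
  exact/hausdorff_accessible/metric_hausdorff.
have fE : finite_set [set L : CMin phi | S (cmin_set L)].
  by apply: (finite_preimage _ fS) => L L' _ _; exact: cmin_set_inj.
have [GE|/existsNP[L /not_implyP[GL nSL]]] :=
  pselect (G `<=` [set L : CMin phi | S (cmin_set L)]).
  exists K; apply: isolated_tame.
  (* G is finite here, so removing its other points leaves an open set *)
  rewrite (_ : [set K] = G `&` ~` (G `\ K)).
    apply: openI => //; apply: closed_openC; apply: clfin.
    by apply: sub_finite_set fE => L [/GE].
  apply/seteqP; split=> [_ ->|L [GL nGL]]; first by split=> // -[_]; apply.
  by apply: contrapT => LK; exact: nGL.
exists L; apply: near_stable_tame => //.
have : nbhs L (G `&` ~` [set L : CMin phi | S (cmin_set L)]).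
  apply: open_nbhs_nbhs; split=> //; apply: openI => //.
  by apply: closed_openC; exact: clfin.
by apply: filterS => L' [/GS].
Qed.

End tame_points.

Theorem mainTheorem9 (R : realType) (M : metricType R) (phi : R -> M -> M)
    (hM : generalized_peano_continuum M) (hphi : is_flow phi)
    (h12 :
      dense [set K : CMin phi | ~ locally_connected_at [set: CMin phi] K]
      \/
      ~ (exists K : CMin phi,
           (exists2 A : set (CMin phi), nbhs K A & compact A) /\
           (exists2 B : set (CMin phi), nbhs K B & locally_connected B))) :
  forall K : set M, compact_minimal_set phi K ->
  forall U : set M, K `<=` U° ->
    infinite_set [set L : set M |
      [/\ compact_minimal_set phi L, lyapunov_unstable phi L & L `<=` U]].
Proof.
move=> K mK U KU finS; case: hM => lkM _ lcM.
have [L tameL] : exists L : CMin phi, has_tame_nbhs L.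
  apply: (near_finite_exceptions_tame hphi (K := MkCMin mK) lkM lcM finS).
  apply: filterS (near_cmin_subset (@open_interior _ U) (KU : MkCMin mK `<=` _)).
  move=> L LU nS; apply: contrapT => uL; apply: nS; split=> //.
    exact: cmin_setP.
  exact: subset_trans LU (@interior_subset _ U).
case: h12 => [denseN|]; last by apply; exists L.
have [_ [B nB lcB]] := tameL.
(* a locally connected neighbourhood B of L makes CMin locally connected at every
   interior point of B, and by density one of these points is excluded *)
have [|L' [BL' nlcL']] := denseN B° _ (@open_interior _ B); first by exists L.
apply: nlcL' => O nO; have [N [nN NBO cN]] := lcB L' (interior_subset BL') O nO.
exists N; split=> //; last by move=> L'' /NBO[].
by rewrite !within_interior ?interiorT// in nN *.
Qed.
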